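(* There is no nontrivial group homomorphism $\mathcal{G}_\infty \to \mathrm{Homeo}_+(S^1)$.
   Context: $\mathrm{Homeo}_+(\mathbb{R})$ and $\mathrm{Homeo}_+(S^1)$ are the groups (under composition) of orientation-preserving homeomorphisms of $\mathbb{R}$ and of the circle $S^1$. The group of germs at infinity $\mathcal{G}_\infty$ is the set of equivalence classes of elements of $\mathrm{Homeo}_+(\mathbb{R})$ under the relation $f \sim g$ if $f$ and $g$ agree on some neighborhood $[x,\infty)$ of $\infty$, with the group operation induced by composition. Homomorphisms are abstract group homomorphisms (no continuity is assumed). *)

(* Defs.v *)
From HB Require Import structures.
From mathcomp Require Import all_boot all_order all_algebra generic_quotient.
From mathcomp Require Import all_classical all_reals all_analysis.
Import Order.TTheory GRing.Theory Num.Theory numFieldNormedType.Exports.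

Set Implicit Arguments.
Unset Strict Implicit.
Unset Printing Implicit Defensive.

Local Open Scope classical_set_scope.
Local Open Scope quotient_scope.
Local Open Scope ring_scope.

Definition homeomorphism (T : topologicalType) (f : T -> T) : Prop :=
  continuous f /\ exists g : T -> T, [/\ continuous g, cancel f g & cancel g f].

Record homeo (T : topologicalType) : Type := Homeo {
  homeo_fun :> T -> T;
  homeo_subproof : `[< homeomorphism homeo_fun >]
}.

HB.instance Definition _ (T : topologicalType) := [isSub for @homeo_fun T].
HB.instance Definition _ (T : topologicalType) := [Choice of homeo T by <:].

Section HomeoGroup.
Variable T : topologicalType.
Implicit Types f g : homeo T.

Lemma homeoP f : homeomorphism f.
Proof. exact/asboolP/homeo_subproof. Qed.

Lemma homeo_ext f g : f =1 g -> f = g.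
Proof. by move=> fg; apply/val_inj/funext. Qed.

Lemma homeomorphism_id : `[< homeomorphism (@id T) >].
Proof.
by apply/asboolP; split; [move=> x; exact: cvg_id|
  exists id; split=> // x; exact: cvg_id].
Qed.

Lemma homeomorphism_comp f g : `[< homeomorphism (f \o g) >].
Proof.
apply/asboolP; have [cf [f' [cf' fK f'K]]] := homeoP f.
have [cg [g' [cg' gK g'K]]] := homeoP g; split.
  by move=> x; apply: continuous_comp; [exact: cg|exact: cf].
exists (g' \o f'); split; last 2 first.
- exact: can_comp.
- exact: can_comp.
by move=> x; apply: continuous_comp; [exact: cf'|exact: cg'].
Qed.

Lemma homeo_has_inv f :
  exists g : T -> T, [/\ continuous g, cancel f g & cancel g f].
Proof. by have [] := homeoP f. Qed.

Definition homeo_inv_fun f : T -> T := projT1 (cid (homeo_has_inv f)).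

Lemma homeo_inv_funP f : [/\ continuous (homeo_inv_fun f),
  cancel f (homeo_inv_fun f) & cancel (homeo_inv_fun f) f].
Proof. by rewrite /homeo_inv_fun; case: cid. Qed.

Lemma homeomorphism_inv f : `[< homeomorphism (homeo_inv_fun f) >].
Proof.
apply/asboolP; have [cf' fK f'K] := homeo_inv_funP f; split=> //.
by exists f; split=> //; have [] := homeoP f.
Qed.

Definition homeo_one : homeo T := Homeo homeomorphism_id.
Definition homeo_mul f g : homeo T := Homeo (homeomorphism_comp f g).
Definition homeo_inv f : homeo T := Homeo (homeomorphism_inv f).

Lemma homeo_mulA : associative homeo_mul.
Proof. by move=> f g h; exact: homeo_ext. Qed.

Lemma homeo_mul1 : left_id homeo_one homeo_mul.
Proof. by move=> f; exact: homeo_ext. Qed.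

Lemma homeo_mulr1 : right_id homeo_one homeo_mul.
Proof. by move=> f; exact: homeo_ext. Qed.

Lemma homeo_mulV : left_inverse homeo_one homeo_inv homeo_mul.
Proof.
move=> f; apply: homeo_ext => x.
by have [_ fK _] := homeo_inv_funP f; exact: fK.
Qed.

Lemma homeo_mulrV : right_inverse homeo_one homeo_inv homeo_mul.
Proof.
move=> f; apply: homeo_ext => x.
by have [_ _ fK] := homeo_inv_funP f; exact: fK.
Qed.

HB.instance Definition _ := isGroup.Build (homeo T)
  homeo_mulA homeo_mul1 homeo_mulr1 homeo_mulV homeo_mulrV.

Lemma homeo1E (x : T) : (1%g : homeo T) x = x.
Proof. by []. Qed.

Lemma homeoME f g (x : T) : (f * g : homeo T)%g x = f (g x).
Proof. by []. Qed.

Lemma homeoK f : cancel f (f^-1 : homeo T)%g.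
Proof. by have [] := homeo_inv_funP f. Qed.

Lemma homeoVK f : cancel (f^-1 : homeo T)%g f.
Proof. by have [] := homeo_inv_funP f. Qed.

End HomeoGroup.

Section HomeoLine.
Variable R : realType.

Definition increasing_homeo : {pred homeo R} :=
  fun f => `[< {homo f : x y / x < y} >].

Lemma increasing_homeo_closed : group_closed increasing_homeo.
Proof.
split=> [|f g /asboolP fi /asboolP gi]; apply/asboolP => // x y xy.
apply: fi; rewrite ltNge; apply/negP; rewrite le_eqVlt => /predU1P[|] h.
  have := congr1 g h; rewrite !homeoVK => /esym exy.
  by rewrite exy ltxx in xy.
by have := gi _ _ h; rewrite !homeoVK ltNge (ltW xy).
Qed.

Record homeo_line : Type := HomeoLine {
  homeo_line_val :> homeo R;
  homeo_line_subproof : homeo_line_val \in increasing_homeo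
}.

HB.instance Definition _ := [isSub for homeo_line_val].
HB.instance Definition _ := [Choice of homeo_line by <:].
HB.instance Definition _ := SubChoice_isSubGroup.Build
  (homeo R) increasing_homeo homeo_line increasing_homeo_closed.

Lemma homeo_line_incr (f : homeo_line) : {homo f : x y / x < y}.
Proof. exact/asboolP/homeo_line_subproof. Qed.

Lemma homeo_line1E (x : R) : (1%g : homeo_line) x = x.
Proof. by []. Qed.

Lemma homeo_lineME (f g : homeo_line) (x : R) :
  (f * g : homeo_line)%g x = f (g x).
Proof. by []. Qed.

Lemma homeo_lineK (f : homeo_line) : cancel f (f^-1 : homeo_line)%g.
Proof. exact: homeoK. Qed.

Lemma homeo_lineVK (f : homeo_line) : cancel (f^-1 : homeo_line)%g f.
Proof. exact: homeoVK. Qed.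

Definition eq_at_infty (f g : homeo_line) : bool :=
  `[< exists x : R, {in `[x, +oo[, f =1 g} >].

Lemma eq_at_infty_refl : reflexive eq_at_infty.
Proof. by move=> f; apply/asboolP; exists 0. Qed.

Lemma eq_at_infty_sym : symmetric eq_at_infty.
Proof.
move=> f g; apply/idP/idP => /asboolP[x fg]; apply/asboolP; exists x => y xy;
by rewrite fg.
Qed.

Lemma eq_at_infty_trans : transitive eq_at_infty.
Proof.
move=> g f h /asboolP[x fg] /asboolP[y gh]; apply/asboolP.
exists (Num.max x y) => z; rewrite in_itv/= andbT ge_max => /andP[xz yz].
by rewrite fg ?gh// in_itv/= andbT.
Qed.

Canonical eq_at_infty_equiv :=
  EquivRel eq_at_infty eq_at_infty_refl eq_at_infty_sym eq_at_infty_trans.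

Definition germ_infty : Type := {eq_quot eq_at_infty}.
HB.instance Definition _ := Choice.on germ_infty.
HB.instance Definition _ := EqQuotient.on germ_infty.

Lemma germP (f g : homeo_line) :
  reflect (exists x : R, {in `[x, +oo[, f =1 g})
          (\pi_germ_infty f == \pi_germ_infty g).
Proof. by rewrite piE; exact: asboolP. Qed.

Definition germ_one : germ_infty := \pi_germ_infty (1 : homeo_line)%g.
Definition germ_mul : germ_infty -> germ_infty -> germ_infty :=
  fun a b => \pi_germ_infty (repr a * repr b : homeo_line)%g.
Definition germ_inv : germ_infty -> germ_infty :=
  fun a => \pi_germ_infty ((repr a)^-1 : homeo_line)%g.

Lemma homeo_line_unbounded (f : homeo_line) (x : R) :
  exists y : R, {in `[y, +oo[, forall z, x <= f z}.
Proof.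
exists ((f^-1 : homeo_line)%g x) => z; rewrite in_itv/= andbT le_eqVlt.
by move=> /predU1P[<-|/(@homeo_line_incr f)/ltW]; rewrite homeo_lineVK.
Qed.

Lemma germ_piM (f g : homeo_line) :
  \pi_germ_infty (f * g : homeo_line)%g =
  germ_mul (\pi_germ_infty f) (\pi_germ_infty g).
Proof.
rewrite /germ_mul; case: piP => f' /eqP/germP[x ff'].
case: piP => g' /eqP/germP[y gg']; apply/eqP/germP.
have [z xg] := homeo_line_unbounded g x.
exists (Num.max y z) => t; rewrite in_itv/= andbT ge_max => /andP[yt zt].
rewrite /= -gg' ?ff' ?in_itv/= ?andbT//.
by apply: xg; rewrite in_itv/= andbT.
Qed.

Lemma germ_piV (f : homeo_line) :
  \pi_germ_infty (f^-1 : homeo_line)%g = germ_inv (\pi_germ_infty f).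
Proof.
rewrite /germ_inv; case: piP => g /eqP/germP[x fg]; apply/eqP/germP.
have [y xf] := homeo_line_unbounded (f^-1 : homeo_line)%g x.
exists y => t yt; apply: (can_inj (homeo_lineK g)).
by rewrite homeo_lineVK -fg ?homeo_lineVK// in_itv/= andbT xf.
Qed.

Lemma germ_mulA : associative germ_mul.
Proof.
elim/quotW => f; elim/quotW => g; elim/quotW => h.
by rewrite -(germ_piM g h) -(germ_piM f g) -(germ_piM f) -(germ_piM _ h) mulgA.
Qed.

Lemma germ_mul1 : left_id germ_one germ_mul.
Proof. by elim/quotW => f; rewrite -(germ_piM _ f) mul1g. Qed.

Lemma germ_mulr1 : right_id germ_one germ_mul.
Proof. by elim/quotW => f; rewrite -(germ_piM f) mulg1. Qed.

Lemma germ_mulV : left_inverse germ_one germ_inv germ_mul.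
Proof. by elim/quotW => f; rewrite -(germ_piV f) -(germ_piM _ f) mulVg. Qed.

Lemma germ_mulrV : right_inverse germ_one germ_inv germ_mul.
Proof. by elim/quotW => f; rewrite -(germ_piV f) -(germ_piM f) mulgV. Qed.

HB.instance Definition _ := isGroup.Build germ_infty
  germ_mulA germ_mul1 germ_mulr1 germ_mulV germ_mulrV.

Lemma germ1E : (1%g : germ_infty) = \pi_germ_infty (1 : homeo_line)%g.
Proof. by []. Qed.

Lemma germME (f g : homeo_line) :
  (\pi_germ_infty f * \pi_germ_infty g = \pi_germ_infty (f * g : homeo_line))%g.
Proof. by rewrite germ_piM. Qed.

Lemma germVE (f : homeo_line) :
  ((\pi_germ_infty f)^-1 = \pi_germ_infty (f^-1 : homeo_line))%g.
Proof. by rewrite germ_piV. Qed.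

End HomeoLine.

Section HomeoCircle.
Variable R : realType.

Definition circle : set (R * R) := [set z | z.1 ^+ 2 + z.2 ^+ 2 = 1].

Lemma circle_param_subproof (t : R) :
  (cos (2 * pi * t), sin (2 * pi * t)) \in circle.
Proof. by rewrite inE /circle/= cos2Dsin2. Qed.

Definition circle_param (t : R) : circle :=
  exist (fun z => z \in circle) _ (circle_param_subproof t).

(* A homeomorphism of the circle preserves orientation when it lifts, through
   the universal covering t |-> exp(2 i pi t), to an orientation-preserving
   homeomorphism of the line. *)
Definition orientation_preserving : {pred homeo circle} :=
  fun f => `[< exists F : homeo_line R,
    forall t, f (circle_param t) = circle_param (F t) >].

Lemma orientation_preserving_closed : group_closed orientation_preserving.
Proof.
split=> [|f g /asboolP[F fF] /asboolP[G gG]]; apply/asboolP.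
  by exists 1%g.
exists (F / G)%g => t; rewrite homeoME homeo_lineME -fF; congr (homeo_fun f _).
by apply: (can_inj (homeoK g)); rewrite homeoVK gG homeo_lineVK.
Qed.

Record homeo_circle : Type := HomeoCircle {
  homeo_circle_val :> homeo circle;
  homeo_circle_subproof : homeo_circle_val \in orientation_preserving
}.

HB.instance Definition _ := [isSub for homeo_circle_val].
HB.instance Definition _ := [Choice of homeo_circle by <:].
HB.instance Definition _ := SubChoice_isSubGroup.Build
  (homeo circle) orientation_preserving homeo_circle
  orientation_preserving_closed.

Lemma homeo_circle_lift (f : homeo_circle) : exists F : homeo_line R,
  forall t, f (circle_param t) = circle_param (F t).
Proof. exact/asboolP/homeo_circle_subproof. Qed.

End HomeoCircle.

Arguments circle : clear implicits.

(* Main.v *)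
Require Import Defs.
From HB Require Import structures.
From mathcomp Require Import all_boot all_order all_algebra generic_quotient.
From mathcomp Require Import all_classical all_reals all_analysis.
From mathcomp Require Import ring lra.

(** The circle enters only through the fact that its homeomorphism group is
    separable: every homomorphism from the group of germs to a separable
    metrizable group is trivial ([germ_morphism_trivial]). The argument is a
    diagonal one, in the spirit of automatic continuity.

    Cut a neighbourhood of infinity into the cells [[n, n + 1]]. Homeomorphisms
    acting independently in the cells form an infinite product, and a germ
    forgets any finite number of factors. In each cell place a homeomorphism
    [doubling] that moves every interior point up; it is its own commutator
    with another homeomorphism, [squaring] ([doubling_commutator]). For a set
    [C] of cells let [d_C] and [s_C] act by [doubling] and [squaring] in the
    cells of [C] and trivially in the others.

    Let [W] be a neighbourhood of 1 in the target. Countably many translates of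
    a smaller neighbourhood cover the target, so they classify the sets [C]
    into countably many classes, according to the image of [s_C] (or [d_C]). If
    the cells are split into infinitely many infinite blocks, some class
    realises every trace on its block ([diagonal_class]): otherwise, choosing
    in the j-th block a trace missed by the j-th class would define a set
    belonging to no class. Two sets of that class, one with trace [C], the
    other with empty trace, have a quotient whose image is small and which
    agrees with [s_C] on the block, but nothing is known about it elsewhere.
    Applying this once to [squaring], and once more to [doubling] within the
    block so obtained, gives two elements such that the cells where both are
    nontrivial are those of [C]; their commutator is exactly [d_C], and its
    image lies in [W] ([extract_small]). Repeating this for a base of
    neighbourhoods yields decreasing infinite sets of cells, and any infinite set [D] almost contained in all of them satisfies
    [phi d_D = 1], as the homomorphism ignores finitely many cells
    ([trivial_on_infinitely_many_cells]).

    It remains to see that the normal closure of [d_D] is everything. A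
    conjugate of [d_D] whose support covers what [d_D] leaves fixed gives a
    product moving every large point up ([moves_up_by_two_conjugates]); all
    germs with this property are conjugate to a translation
    ([conj_translation]), so they are all in the kernel, and they generate the
    group ([dominating]). *)

Import Order.TTheory GRing.Theory Num.Theory numFieldNormedType.Exports.

Set Implicit Arguments.
Unset Strict Implicit.
Unset Printing Implicit Defensive.

Local Open Scope classical_set_scope.
Local Open Scope ring_scope.

(** * Building homeomorphisms of the line *)

Lemma increasing_surjection_homeo_line (R : realType) (f g : R -> R) :
  {homo f : x y / x < y} -> cancel g f -> exists h : homeo_line R, h =1 f.
Proof.
move=> fi gK.
have fK : cancel f g.
  by apply: (inj_can_sym gK); apply: inc_inj; apply: le_mono.
have gi : {homo g : x y / x < y}.
  move=> x y xy; rewrite ltNge; apply/negP; rewrite le_eqVlt => /predU1P[e|/fi].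
    by move/(congr1 f): e xy; rewrite !gK => ->; rewrite ltxx.
  by rewrite !gK ltNge (ltW xy).
have cont (u v : R -> R) : {homo u : x y / x < y} -> {homo v : x y / x < y} ->
    cancel u v -> cancel v u -> continuous u.
  move=> ui vi uK vK x; apply/cvgrPdist_lt => e e0.
  have lo : v (u x - e) < x by rewrite -[ltRHS]uK; apply: vi; lra.
  have hi : x < v (u x + e) by rewrite -[ltLHS]uK; apply: vi; lra.
  near=> y.
  have /ui : v (u x - e) < y by near: y; exact: lt_nbhsr.
  have /ui : y < v (u x + e) by near: y; exact: lt_nbhsl.
  by rewrite !vK ltr_norml; lra.
have hf : `[< homeomorphism f >].
  apply/asboolP; split; first exact: (cont f g).
  by exists g; split => //; exact: (cont g f).
have fl : Homeo hf \in increasing_homeo (R := R) by apply/asboolP.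
by exists (HomeoLine fl).
Unshelve. all: by end_near. Qed.

Section Gluing.
Variable R : realType.
Implicit Types (f g h : homeo_line R) (x y : R) (n : nat).

Lemma homeo_line_lt f : {mono f : x y / x < y}.
Proof. exact/leW_mono/le_mono/homeo_line_incr. Qed.

Lemma homeo_line_le f : {mono f : x y / x <= y}.
Proof. exact/le_mono/homeo_line_incr. Qed.

Definition homeo_line_of (u : R -> R) : homeo_line R :=
  xget 1%g [set h : homeo_line R | h =1 u].

Lemma homeo_line_ofE (u v : R -> R) :
  {homo u : x y / x < y} -> cancel v u -> homeo_line_of u =1 u.
Proof.
move=> ui vK.
exact: (xgetPex 1%g (increasing_surjection_homeo_line ui vK)).
Qed.

Definition affine (a c : R) : homeo_line R :=
  homeo_line_of (fun x => a * x + c).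

Lemma affineE a c x : 0 < a -> affine a c x = a * x + c.
Proof.
move=> a0; apply: (@homeo_line_ofE _ (fun y => (y - c) / a)) => [y z|y /=].
  by rewrite ltrD2r ltr_pM2l.
by rewrite mulrC divfK ?subrK// gt_eqF.
Qed.

(** The q_n are to be used on [[n, n + 1]]: they must match at the endpoints,
    and the images of these intervals must reach infinity. *)
Definition gluable (q : nat -> homeo_line R) : Prop :=
  (forall n, q n n.+1%:R = q n.+1 n.+1%:R) /\
  (forall y, exists n, y < q n n.+1%:R).

(** [truncn x] is 0 for negative x, so q_0 is also used on the negative
    half-line. *)
Definition piecewise (q : nat -> homeo_line R) : homeo_line R :=
  homeo_line_of (fun x => q (Num.truncn x) x).

Lemma piecewiseE q x : gluable q -> piecewise q x = q (Num.truncn x) x.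
Proof.
move=> [qS qoo].
have qmono m n : (m <= n)%N -> q m m%:R <= q n n%:R.
  elim: n => [|n IH]; first by rewrite leqn0 => /eqP ->.
  rewrite leq_eqVlt => /predU1P[->//|/IH/le_trans]; apply.
  by rewrite -qS homeo_line_le ler_nat.
have qmono' m n : (m < n)%N -> q m m.+1%:R <= q n n%:R.
  by rewrite qS; exact: qmono.
have surj y : exists z, q (Num.truncn z) z = y.
  (* y is attained on the first interval whose image goes beyond it. *)
  case: (ex_minnP (qoo y)) => n yn nmin.
  pose z := (q n)^-1%g y; exists z.
  have qz : q n z = y by rewrite homeo_lineVK.
  have zn : z < n.+1%:R by rewrite -(homeo_line_lt (q n)) qz.
  suff -> : Num.truncn z = n by [].
  case: n => [|n] in yn nmin z qz zn *.
    by apply/eqP; rewrite -leqn0 truncn_le_nat.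
  apply: truncn_def; rewrite zn andbT -(homeo_line_le (q n.+1)) qz -qS leNgt.
  by apply/negP => /nmin; rewrite ltnn.
have [v vK] := choice surj.
apply: (@homeo_line_ofE _ v) => // y z yz.
have := le_truncn (ltW yz); rewrite leq_eqVlt => /predU1P[->|tyz].
  by rewrite homeo_line_lt.
apply: (@lt_le_trans _ _ (q (Num.truncn y) (Num.truncn y).+1%:R)).
  by rewrite homeo_line_lt truncnS_gt.
apply: (le_trans (qmono' _ _ tyz)); rewrite homeo_line_le truncn_le.
by have := leq_ltn_trans (leq0n _) tyz; rewrite truncn_gt0; exact: le_trans.
Qed.

Definition fixes01 f : Prop := f 0 = 0 /\ f 1 = 1.

Lemma fixes01M f g : fixes01 f -> fixes01 g -> fixes01 (f * g)%g.
Proof. by move=> [f0 f1] [g0 g1]; split; rewrite homeo_lineME ?g0 ?g1. Qed.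

Lemma fixes01V f : fixes01 f -> fixes01 f^-1%g.
Proof.
move=> [f0 f1]; split; first by rewrite -{1}f0 homeo_lineK.
by rewrite -{1}f1 homeo_lineK.
Qed.

(** On the n-th cell [[n, n + 1]] acts a copy of l_n, transported by a
    translation; the sequences l form an infinite product of groups, and
    [cellwiseM] and [cellwiseV] embed it in the homeomorphisms of the line. *)
Definition cellwise (l : nat -> homeo_line R) : homeo_line R :=
  piecewise (fun n => affine 1 n%:R * l n * affine 1 (- n%:R))%g.

Lemma cellwiseE l x : (forall n, fixes01 (l n)) ->
  cellwise l x = (Num.truncn x)%:R + l (Num.truncn x) (x - (Num.truncn x)%:R).
Proof.
move=> l01.
have E n y : (affine 1 n%:R * l n * affine 1 (- n%:R))%g y
    = n%:R + l n (y - n%:R).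
  by rewrite !homeo_lineME !affineE ?ltr01// !mul1r addrC.
have Er n : (affine 1 n%:R * l n * affine 1 (- n%:R))%g n.+1%:R = n.+1%:R :> R.
  have [_ l1] := l01 n.
  by rewrite E -natr1 [X in l n X]addrAC subrr add0r l1.
rewrite piecewiseE ?E//; split=> [n|y].
  by rewrite Er E subrr; have [-> _] := l01 n.+1; rewrite addr0.
by exists (Num.truncn y); rewrite Er truncnS_gt.
Qed.

Lemma truncn_cellwise l x : (forall n, fixes01 (l n)) ->
  Num.truncn (cellwise l x) = Num.truncn x.
Proof.
move=> l01; rewrite cellwiseE//; have [l0 l1] := l01 (Num.truncn x).
have [x0|x0] := leP 0 x.
  apply: truncn_def; have /andP[nx xn] := truncn_itv x0.
  rewrite lerDl -[X in X <= _]l0 homeo_line_le subr_ge0 nx/=.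
  by rewrite -addn1 natrD ltrD2l -[ltRHS]l1 homeo_line_lt ltrBlDl natr1.
have tx : Num.truncn x = 0%N.
  by apply/eqP; rewrite -leqn0 truncn_le_nat (lt_trans x0).
rewrite tx in l0 *; apply/eqP; rewrite -leqn0 truncn_le_nat add0r subr0.
by rewrite (@lt_trans _ _ 0)// -[ltRHS]l0 homeo_line_lt.
Qed.

Lemma homeo_line_ext f g : f =1 g -> f = g.
Proof. by move=> fg; do 2! apply: val_inj; apply/funext => x; exact: fg. Qed.

Lemma cellwiseM l l' :
  (forall n, fixes01 (l n)) -> (forall n, fixes01 (l' n)) ->
  cellwise (fun n => l n * l' n)%g = (cellwise l * cellwise l')%g.
Proof.
move=> l01 l01'; apply: homeo_line_ext => x.
have l01'' n : fixes01 (l n * l' n)%g by exact: fixes01M.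
rewrite homeo_lineME cellwiseE// [RHS]cellwiseE// truncn_cellwise//.
rewrite [in RHS]cellwiseE// homeo_lineME.
by rewrite [X in _ = _ + l _ X]addrAC subrr add0r.
Qed.

Lemma cellwise1 : cellwise (fun=> 1%g) = 1%g.
Proof.
apply: homeo_line_ext => x; rewrite cellwiseE//.
by rewrite !homeo_line1E addrCA subrr addr0.
Qed.

Lemma cellwiseV l : (forall n, fixes01 (l n)) ->
  cellwise (fun n => (l n)^-1)%g = (cellwise l)^-1%g.
Proof.
move=> l01; apply: (@mulgI _ (cellwise l)); rewrite mulgV.
rewrite -cellwiseM//; last by move=> n; exact: fixes01V.
by rewrite -cellwise1; congr cellwise; apply/funext => n; rewrite mulgV.
Qed.

End Gluing.

(** * A commutator supported on the unit interval *)

Section Bump.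
Variable R : realType.

Definition unit_bump (u : R -> R) : homeo_line R :=
  homeo_line_of (fun x => if 0 < x < 1 then u x else x).

Lemma unit_bumpE (u v : R -> R) :
  (forall x, 0 < x < 1 -> 0 < u x < 1) ->
  (forall x, 0 < x < 1 -> 0 < v x < 1) ->
  (forall x y, 0 < x -> x < y -> y < 1 -> u x < u y) ->
  (forall x, 0 < x < 1 -> u (v x) = x) ->
  unit_bump u =1 fun x => if 0 < x < 1 then u x else x.
Proof.
move=> u01 v01 ui vK.
apply: (@homeo_line_ofE _ _ (fun x => if 0 < x < 1 then v x else x))
  => [x y xy|x].
  case: ifPn => hx; case: ifPn => hy //.
  - by apply: ui => //; [case/andP: hx|case/andP: hy].
  - have /andP[_ ux] := u01 _ hx; have /andP[x0 _] := hx.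
    by move: hy; rewrite (lt_trans x0 xy)/= -leNgt => /(lt_le_trans ux).
  - have /andP[uy _] := u01 _ hy; have /andP[_ y1] := hy.
    by move: hx; rewrite (lt_trans xy y1) andbT -leNgt => /le_lt_trans; apply.
case: (boolP (0 < x < 1)) => [hx|/negPf hx]; last by rewrite hx.
by rewrite v01// vK.
Qed.

(** Through the coordinate x / (1 - x), which identifies the interval ]0, 1[
    with the positive half-line, [doubling] is y |-> 2 y and [squaring] is
    y |-> y ^ 2; whence the relation behind [doubling_commutator]. *)
Definition doubling : homeo_line R := unit_bump (fun x => 2 * x / (1 + x)).

Definition squaring : homeo_line R :=
  unit_bump (fun x => x ^+ 2 / (x ^+ 2 + (1 - x) ^+ 2)).

Lemma doublingE x : doubling x = if 0 < x < 1 then 2 * x / (1 + x) else x.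
Proof.
apply: (@unit_bumpE _ (fun y => y / (2 - y))) => {x} [x|x|x y|x].
- move=> /andP[x0 x1]; have x1' : 0 < 1 + x by lra.
  by rewrite divr_gt0 ?ltr_pdivrMr//=; lra.
- move=> /andP[x0 x1]; have x1' : 0 < 2 - x by lra.
  by rewrite divr_gt0 ?ltr_pdivrMr//=; lra.
- move=> x0 xy y1; have x1' : 0 < 1 + x by lra.
  have y1' : 0 < 1 + y by lra.
  by rewrite ltr_pdivrMr// mulrAC ltr_pdivlMr//; nra.
- by move=> /andP[x0 x1]; field; apply/andP; split; apply: lt0r_neq0; lra.
Qed.

Lemma squaringE x :
  squaring x = if 0 < x < 1 then x ^+ 2 / (x ^+ 2 + (1 - x) ^+ 2) else x.
Proof.
have D0 y : 0 < y < 1 -> 0 < y ^+ 2 + (1 - y) ^+ 2.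
  by move=> /andP[y0 y1]; rewrite addr_gt0// exprn_gt0// subr_gt0.
have sq y : 0 < y < 1 -> [/\ 0 < Num.sqrt y, 0 < Num.sqrt (1 - y),
    Num.sqrt y ^+ 2 = y & Num.sqrt (1 - y) ^+ 2 = 1 - y].
  move=> /andP[y0 y1]; have y1' : 0 < 1 - y by lra.
  by rewrite !sqrtr_gt0 y0 y1' !sqr_sqrtr// ltW.
apply: (@unit_bumpE _ (fun y => Num.sqrt y / (Num.sqrt y + Num.sqrt (1 - y))))
  => {x} [x|x|x y|x].
- move=> /[dup] /D0 Dx /andP[x0 x1].
  rewrite divr_gt0 ?ltr_pdivrMr ?exprn_gt0//= mul1r ltrDl.
  by rewrite exprn_gt0// subr_gt0.
- move=> /sq[s0 s1 _ _].
  by rewrite divr_gt0 ?ltr_pdivrMr ?addr_gt0//= mul1r ltrDl.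
- move=> x0 xy y1.
  have Dx : 0 < x ^+ 2 + (1 - x) ^+ 2 by rewrite D0// x0/=; lra.
  have Dy : 0 < y ^+ 2 + (1 - y) ^+ 2 by rewrite D0// y1 andbT; lra.
  rewrite ltr_pdivrMr// mulrAC ltr_pdivlMr//.
  have h : x * (1 - y) < y * (1 - x) by lra.
  have : (x * (1 - y)) ^+ 2 < (y * (1 - x)) ^+ 2.
    by rewrite ltr_pXn2r// nnegrE mulr_ge0//; lra.
  by rewrite !exprMn; lra.
- move=> /sq[s0 s1 e0 e1]; set a := Num.sqrt x in s0 e0 *.
  set b := Num.sqrt (1 - x) in s1 e1 *.
  have ab : a ^+ 2 + b ^+ 2 = 1 by rewrite e0 e1; lra.
  have abn : a + b != 0 by apply: lt0r_neq0; lra.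
  have -> : 1 - a / (a + b) = b / (a + b) by field.
  by rewrite !expr_div_n -mulrDl ab -[RHS]e0; field.
Qed.

Lemma doubling_fixes01 : fixes01 doubling.
Proof. by split; rewrite doublingE ?ltxx ?andbF. Qed.

Lemma squaring_fixes01 : fixes01 squaring.
Proof. by split; rewrite squaringE ?ltxx ?andbF. Qed.

Lemma doubling_gt x : 0 < x < 1 -> x < doubling x.
Proof.
move=> x01; rewrite doublingE x01; case/andP: x01 => x0 x1.
by rewrite ltr_pdivlMr; nra.
Qed.

Lemma doubling_ge x : x <= doubling x.
Proof.
have [/doubling_gt/ltW//|/negPf h] := boolP (0 < x < 1).
by rewrite doublingE h.
Qed.

(** On the half-line, (2 y) ^ 2 = 4 y ^ 2: conjugating [doubling] by [squaring]
    gives the square of [doubling]. *)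
Lemma doubling_commutator :
  (squaring * doubling * squaring^-1 * doubling^-1)%g = doubling.
Proof.
suff E : (squaring * doubling = doubling * doubling * squaring)%g.
  by rewrite E !mulgK.
apply: homeo_line_ext => x; rewrite !homeo_lineME.
have [x01|/negPf x01] := boolP (0 < x < 1); last first.
  by do ![rewrite ?doublingE ?squaringE x01].
have dx : 0 < doubling x < 1.
  rewrite doublingE x01; case/andP: x01 => x0 x1.
  by rewrite divr_gt0 ?ltr_pdivrMr//=; lra.
have D : 0 < x ^+ 2 + (1 - x) ^+ 2.
  case/andP: x01 => x0 x1; nra.
have D' : 0 < 4 * x ^+ 2 + (1 - x) ^+ 2.
  case/andP: x01 => x0 x1; nra.
have D'' : 0 < 2 * x ^+ 2 + (1 - x) ^+ 2.
  case/andP: x01 => x0 x1; nra.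
have sx : 0 < squaring x < 1.
  rewrite squaringE x01; case/andP: x01 => x0 x1.
  by rewrite divr_gt0 ?ltr_pdivrMr//=; nra.
have dsx : doubling (squaring x) = 2 * x ^+ 2 / (2 * x ^+ 2 + (1 - x) ^+ 2).
  rewrite doublingE sx squaringE x01; field.
  by apply/andP; split; apply: lt0r_neq0; lra.
have dsx01 : 0 < doubling (squaring x) < 1.
  rewrite dsx; case/andP: x01 => x0 x1.
  by rewrite divr_gt0 ?ltr_pdivrMr//=; nra.
rewrite squaringE dx doublingE x01 [RHS]doublingE dsx01 dsx; field.
case/andP: x01 => x0 x1.
by rewrite !lt0r_neq0 //; nra.
Qed.

End Bump.

(** * Extracting cells on which a homomorphism is small *)

Section Selection.
Local Open Scope nat_scope.

(** A set is assembled from one trace for each value of [b]; if each class j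
    missed the trace chosen on the block [b = j], the assembled set would have
    no class. *)
Lemma diagonal_class (T : Type) (b : T -> nat) (c : pred T -> nat) :
  exists j, forall C0 : pred T, exists C : pred T,
    c C = j /\ forall x, b x = j -> C x = C0 x.
Proof.
apply: contrapT => /forallNP noj.
have bad j : exists C0 : pred T,
    forall C : pred T, c C = j -> ~ forall x, b x = j -> C x = C0 x.
  have /existsNP[C0 /forallNP hC0] := noj j.
  by exists C0 => C cj CC0; apply: (hC0 C).
have [C0 hC0] := choice bad.
pose C := (fun x => C0 (b x) x) : pred T.
by apply: (hC0 (c C) C erefl) => x bx; rewrite /C bx.
Qed.

Lemma injective_unbounded (e : nat -> nat) N :
  injective e -> exists k, N <= e k.
Proof.
move=> ei; apply: contrapT => /forallNP noN.
have eN k : e k < N by rewrite ltnNge; apply/negP/noN.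
have fi : injective (fun i : 'I_N.+1 => Ordinal (eN i)).
  by move=> i j [] /ei ij; exact: val_inj.
by have := leq_card _ fi; rewrite !card_ord ltnn.
Qed.

Lemma left_inverse_of (T : pointedType) (U : Type) (e : T -> U) :
  injective e -> exists i : U -> T, cancel e i.
Proof.
move=> ei; have /choice[i hi] : forall y, exists t,
    forall t', e t' = y -> t' = t.
  move=> y; have [[t ty]|noy] := pselect (exists t, e t = y).
    by exists t => t' t'y; apply: ei; rewrite ty.
  by exists point => t' t'y; case: noy; exists t'.
by exists i => t; rewrite -(hi _ t).
Qed.

End Selection.

Section GermHomomorphism.
Variables (R : realType) (H : groupType).
Variables (phi : {multiplicative germ_infty R -> H}).
Implicit Types (f g : homeo_line R) (C D : pred nat) (n m k : nat).
Local Open Scope quotient_scope.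

Definition germ_image f : H := phi (\pi_(germ_infty R) f).

Lemma germ_image_eq f g x : (forall y, x <= y -> f y = g y) ->
  germ_image f = germ_image g.
Proof.
move=> fg; congr (phi _); apply/eqP/germP; exists x => y.
by rewrite in_itv/= andbT => /fg.
Qed.

Lemma germ_imageM f g : germ_image (f * g)%g = (germ_image f * germ_image g)%g.
Proof. by rewrite /germ_image -gmulfM germME. Qed.

Lemma germ_image1 : germ_image 1%g = 1%g.
Proof.
by apply: (@mulgI _ (germ_image 1%g)); rewrite -germ_imageM !mulg1.
Qed.

Lemma germ_imageV f : germ_image f^-1%g = (germ_image f)^-1%g.
Proof.
apply: (@mulgI _ (germ_image f)).
by rewrite -germ_imageM !mulgV germ_image1.
Qed.

Definition on_cells f C : homeo_line R :=
  cellwise (fun n => if C n then f else 1%g).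

Lemma on_cellsE f C x : fixes01 f -> on_cells f C x =
  if C (Num.truncn x) then (Num.truncn x)%:R + f (x - (Num.truncn x)%:R) else x.
Proof.
move=> f01; rewrite cellwiseE => [|n]; last by case: ifP.
by case: ifP => // _; rewrite homeo_line1E addrC subrK.
Qed.

(** In a cell outside of [C] one of the two quotients is trivial, so the
    commutator is trivial there, whatever the other one is. *)
Lemma on_cells_commutator f g C C1 C2 C1' C2' : fixes01 f -> fixes01 g ->
  (f * g * f^-1 * g^-1 = g)%g ->
  (forall n, if C n then [/\ C1 n, ~~ C2 n, C1' n & ~~ C2' n]
             else (C1 n = C2 n) \/ (C1' n = C2' n)) ->
  let a := (on_cells f C1 / on_cells f C2)%g in
  let b := (on_cells g C1' / on_cells g C2')%g in
  (a * b * a^-1 * b^-1)%g = on_cells g C.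
Proof.
move=> f01 g01 fg hC a b.
have h01 u (B : pred nat) : fixes01 u -> forall n,
    fixes01 (if B n then u else 1%g).
  by move=> u01 n; case: ifP.
have hd u (B B' : pred nat) : fixes01 u -> forall n,
    fixes01 ((if B n then u else 1) / (if B' n then u else 1))%g.
  by move=> u01 n; apply: fixes01M; last apply: fixes01V; exact: h01.
have E u (B B' : pred nat) : fixes01 u ->
    (on_cells u B / on_cells u B')%g =
    cellwise (fun n => ((if B n then u else 1) / (if B' n then u else 1))%g).
  move=> u01; rewrite cellwiseM; try exact: h01; last first.
    by move=> n; apply: fixes01V; exact: h01.
  by rewrite cellwiseV//; exact: h01.
rewrite /a /b !E//.
rewrite -!cellwiseV -?cellwiseM; try (move=> n;
  do ?[apply: fixes01M|apply: fixes01V]; (exact: h01 || exact: hd)).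
congr cellwise; apply/funext => n.
have := hC n; case: (C n) => [[-> /negPf-> -> /negPf->]|].
  by rewrite !invg1 !mulg1 fg.
by case=> ->; rewrite mulgV ?invg1 ?mulg1 ?mul1g ?mulgV ?mul1g.
Qed.

(** The cells enumerated by [e] are indexed by triples (j, i, k). The first
    application of [diagonal_class] fixes j, and so a block on which the traces
    for [squaring] can be prescribed. The second one, for sets of cells within
    that block, fixes i. The remaining index k enumerates the cells kept. *)
Lemma extract_small (W : set H) (c : H -> nat) (e : nat -> nat) :
  (forall a a' b b', c a = c a' -> c b = c b' ->
     W ((a / a') * (b / b') * (a / a')^-1 * (b / b')^-1)%g) ->
  injective e -> exists r : nat -> nat, injective r /\
    forall C, (forall n, C n -> exists k, n = e (r k)) ->
      W (germ_image (on_cells (doubling R) C)).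
Proof.
move=> cW ei.
pose E (t : nat * nat * nat) := e (pickle t).
have Ei : injective E by exact: (inj_comp ei (pcan_inj pickleK)).
have [inv Einv] := left_inverse_of Ei.
pose s := squaring R; pose d := doubling R.
have [j hj] := diagonal_class (fun n => (inv n).1.1)
  (fun C => c (germ_image (on_cells s C))).
(* Restricting to the block j confines the second family to the cells where
   the first one is under control. *)
pose cut C : pred nat := fun n => ((inv n).1.1 == j) && C n.
have [i hi] := diagonal_class (fun n => (inv n).1.2)
  (fun C => c (germ_image (on_cells d (cut C)))).
exists (fun k => pickle (j, i, k)); split.
  by move=> k k' /(pcan_inj pickleK)[].
move=> C hC.
have C_in n : C n -> (inv n).1.1 = j /\ (inv n).1.2 = i.
  by move=> /hC[k ->]; rewrite -[e _]/(E (j, i, k)) Einv.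
have [C1 [c1 hC1]] := hj C; have [C2 [c2 hC2]] := hj pred0.
have [C1' [c1' hC1']] := hi C; have [C2' [c2' hC2']] := hi pred0.
rewrite -(@on_cells_commutator s d C C1 C2 (cut C1') (cut C2')).
- rewrite !(germ_imageM, germ_imageV); apply: cW; first by rewrite c1.
  by rewrite c1'.
- exact: squaring_fixes01.
- exact: doubling_fixes01.
- exact: doubling_commutator.
move=> n; case: ifPn => [Cn|nCn].
  have [nj ni] := C_in n Cn.
  by rewrite hC1// hC2// /cut nj eqxx hC1'// hC2'.
have [nj|nj] := eqVneq (inv n).1.1 j; last first.
  by right; rewrite /cut (negPf nj).
by left; rewrite hC1// hC2// (negPf nCn).
Qed.
End GermHomomorphism.

Section Separable.

(** A form of separability without topology, valid in all separable metrizable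
    groups: the [W m] play the role of a base of neighbourhoods of 1, and [c]
    labels the members of a countable cover by translates of a neighbourhood
    so small that commutators of quotients of equally labelled elements are in
    [W m]. *)
Definition separable_group (H : groupType) : Prop :=
  exists W : nat -> set H,
    (forall m, exists c : H -> nat,
       forall a a' b b', c a = c a' -> c b = c b' ->
       W m ((a / a') * (b / b') * (a / a')^-1 * (b / b')^-1)%g) /\
    (forall h, (forall m, W m h) -> h = 1%g).

(** The sets enumerated by [e m] decrease, and the image of any set of cells
    enumerated by [e m.+1] is in [W m]. The set [D] picks one cell from each,
    so it is contained in each of them up to finitely many cells, and the
    homomorphism does not see these. *)
Lemma trivial_on_infinitely_many_cells (R : realType) (H : groupType)
    (phi : {multiplicative germ_infty R -> H}) :
  separable_group H ->
  exists D : pred nat, (forall N, exists n, (N <= n)%N && D n) /\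
    germ_image phi (on_cells (doubling R) D) = 1%g.
Proof.
move=> [W [cW W1]].
(* [r (m, e)] is the refinement of the enumeration [e] that suits [W m]. *)
have /choice[r hr] : forall me : nat * (nat -> nat), exists r : nat -> nat,
    injective me.2 -> injective r /\
    forall C : pred nat, (forall n, C n -> exists k, n = me.2 (r k)) ->
      W me.1 (germ_image phi (on_cells (doubling R) C)).
  move=> [m e]; have [ei|nei] := pselect (injective e); last by exists id.
  by have [c hc] := cW m; have [r hr] := extract_small phi hc ei; exists r.
pose e := fix e m := if m is m'.+1 then e m' \o r (m', e m') else id.
have ei m : injective (e m).
  by elim: m => //= m IH; apply: inj_comp => //; have [] := hr (m, e m) IH.
have sub m n k : (m <= n)%N -> exists k', e n k = e m k'.
  move=> /subnK <-; elim: (n - m)%N k => [|i IH] k; first by exists k.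
  by rewrite addSn /=; apply: IH.
have /choice[k hk] : forall m, exists k, (m <= e m.+1 k)%N.
  by move=> m; exact: injective_unbounded.
pose d m := e m.+1 (k m).
pose D : pred nat := fun n => `[< exists m, n = d m >].
exists D; split=> [N|].
  by exists (d N); rewrite hk; apply/asboolP; exists N.
apply: W1 => m.
pose N := (\max_(i < m) d i).+1.
pose C : pred nat := fun n => (N <= n)%N && D n.
have [d0 d1] := doubling_fixes01 R.
rewrite (@germ_image_eq _ _ phi _ (on_cells (doubling R) C) N%:R); last first.
  move=> y Ny; rewrite !on_cellsE// /C truncn_ge_nat ?Ny//.
  exact: le_trans Ny.
have [_] := hr (m, e m) (ei m); apply => n /andP[Nn /asboolP[i ni]].
have [im|mi] := ltnP i m; last first.
  by have [k' ek'] := sub m.+1 i.+1 (k i) mi; exists k'; rewrite ni /d ek'.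
suff : (n < N)%N by rewrite ltnNge Nn.
by rewrite ltnS ni; exact: (@leq_bigmax _ (fun i : 'I_m => d i) (Ordinal im)).
Qed.

End Separable.

(** * Germs moving points up *)

Section Conjugation.
Variable R : realType.
Implicit Types (f g h : homeo_line R) (x y : R) (D : pred nat).

Definition interpolate (p : nat -> R) : homeo_line R :=
  piecewise (fun n => affine (p n.+1 - p n) (p n - n%:R * (p n.+1 - p n))).

Lemma interpolateE (p : nat -> R) n : (forall n, p n < p n.+1) ->
  (forall y, exists n, y < p n) -> interpolate p n%:R = p n.
Proof.
move=> pi poo.
have E m x : affine (p m.+1 - p m) (p m - m%:R * (p m.+1 - p m)) x =
    p m + (x - m%:R) * (p m.+1 - p m).
  by rewrite affineE ?subr_gt0//; ring.
have Er m : affine (p m.+1 - p m) (p m - m%:R * (p m.+1 - p m)) m.+1%:R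
    = p m.+1.
  by rewrite E -natr1; ring.
rewrite /interpolate piecewiseE; first by rewrite natrK E subrr mul0r addr0.
split=> [m|y]; first by rewrite Er E subrr mul0r addr0.
have [m ym] := poo y; exists m; rewrite Er; exact: (lt_trans ym).
Qed.

(** Since [f] moves points up, the intervals between consecutive points of the
    orbit of [x0] exhaust a neighbourhood of infinity: they are fundamental
    domains for [f], as the cells are for the translation. So h is affine on
    the first cell and is then determined by the conjugation relation. *)
Lemma conj_translation f x0 : (forall x, x0 <= x -> x < f x) ->
  exists h, forall x, 0 <= x -> f (h x) = h (x + 1).
Proof.
move=> fx.
have fx0 : 0 < f x0 - x0 by rewrite subr_gt0 fx.
pose p n := (f ^+ n)%g x0.
have pS n : p n.+1 = f (p n) by rewrite /p expgS.
have p0 n : x0 <= p n.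
  elim: n => [|n IH]; first by rewrite /p expg0.
  by rewrite pS; exact/ltW/(le_lt_trans IH)/fx.
have poo y : exists n, y < p n.
  apply: contrapT => /forallNP noy.
  have py n : p n <= y by rewrite leNgt; apply/negP/noy.
  have hs : has_sup (range p).
    by split; [exists (p 0%N), 0%N|exists y => _ [n _ <-]].
  pose s := sup (range p).
  have ps n : p n <= s by apply: ub_le_sup; [case: hs|exists n].
  (* The supremum of a bounded orbit would be moved up, and so would be passed
     by the orbit. *)
  have : f^-1%g s < s.
    by rewrite -(homeo_line_lt f) homeo_lineVK fx// (le_trans (p0 0%N)).
  have p_neq0 : range p !=set0 by case: hs.
  move=> /(sup_gt p_neq0)[_ [n _ <-]].
  by rewrite -(homeo_line_lt f) homeo_lineVK -pS ltNge ps.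
pose a := affine (f x0 - x0) x0.
have aE x : a x = (f x0 - x0) * x + x0 by exact: affineE.
pose q n := (f ^+ n * a * affine 1 (- n%:R))%g.
have qE n x : q n x = (f ^+ n)%g (a (x - n%:R)).
  by rewrite /q !homeo_lineME affineE// mul1r.
have q0 n : q n n%:R = p n by rewrite qE subrr aE mulr0 add0r.
have q1 n : q n n.+1%:R = p n.+1.
  by rewrite qE -natr1 addrAC subrr add0r aE mulr1 subrK /p expgSr.
have qg : gluable q.
  split=> [n|y]; first by rewrite q1 q0.
  have [n yn] := poo y; exists n; rewrite q1 pS; apply: (lt_trans yn).
  exact/fx/p0.
exists (piecewise q) => x x_ge0.
have tx : Num.truncn (x + 1) = (Num.truncn x).+1.
  have /andP[nx xn] := truncn_itv x_ge0.
  by apply: truncn_def; rewrite -natr1 lerD2r nx/= -natr1 ltrD2r.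
rewrite !piecewiseE// tx !qE expgS homeo_lineME -natr1; congr (f (_ (a _))).
by ring.
Qed.

Lemma on_cells_doubling_ge D x : x <= on_cells (doubling R) D x.
Proof.
rewrite on_cellsE; last exact: doubling_fixes01.
by case: ifP => // _; rewrite -lerBlDl doubling_ge.
Qed.

Lemma on_cells_doubling_gt D n x : D n -> n%:R < x < n.+1%:R ->
  x < on_cells (doubling R) D x.
Proof.
move=> Dn /andP[nx xn].
have tx : Num.truncn x = n by apply: truncn_def; rewrite ltW.
rewrite on_cellsE; last exact: doubling_fixes01.
by rewrite tx Dn -ltrBlDl doubling_gt// subr_gt0 nx/= ltrBlDl natr1.
Qed.

(** The element t moves up the interior of the cells of [D]. The conjugating
    map h sends each such cell [[n, n + 1]] to an interval beginning inside the
    cell and ending inside the next cell of [D]; these intervals cover the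
    large points that t fixes. *)
Lemma moves_up_by_two_conjugates D : (forall N, exists n, (N <= n)%N && D n) ->
  let t := on_cells (doubling R) D in
  exists h x0, forall x, x0 <= x -> x < (t * (h * t * h^-1))%g x.
Proof.
move=> Doo t.
pose next n := ex_minn (Doo n).
have next_ge n : (n <= next n)%N by rewrite /next; case: ex_minnP => m /andP[].
have next_D n : D (next n) by rewrite /next; case: ex_minnP => m /andP[].
have next_min n m : (n <= m)%N -> D m -> (next n <= m)%N.
  move=> nm Dm; rewrite /next; case: ex_minnP => k _; apply.
  by rewrite nm Dm.
(* The p_n are the images of the integers under h: p_n lies in the first cell
   of [D] from n on. As several n may share this cell, a decreasing correction
   keeps them distinct. *)
have [c c_lt c01] : exists2 c : nat -> R,
    forall n, c n.+1 < c n & forall n, 0 < c n < 1.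
  exists (fun n => n.+2%:R^-1) => n.
    by rewrite ltf_pV2 ?posrE ?ltr0n// ltr_nat.
  by rewrite invr_gt0 ltr0n invf_lt1 ?ltr0n// ltr1n.
pose p n : R := (next n)%:R + 1 - c n.
have p_lt n : p n < p n.+1.
  have nn : (next n)%:R <= (next n.+1)%:R :> R.
    by rewrite ler_nat next_min// (leq_trans (leqnSn n)).
  by have := c_lt n; rewrite /p; lra.
have p_gt n : (next n)%:R < p n by have := c01 n; rewrite /p; lra.
have p_lt1 n : p n < (next n).+1%:R.
  by have := c01 n; rewrite /p -natr1; lra.
have poo y : exists n, y < p n.
  exists (Num.truncn y).+1; apply: lt_trans (p_gt _).
  by apply: (lt_le_trans (truncnS_gt y)); rewrite ler_nat next_ge.
pose h := interpolate p.
have hE n : h n%:R = p n by exact: interpolateE.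
exists h, (next 0%N).+1%:R => x x0x.
rewrite !homeo_lineME; set z := (h^-1)%g x.
have xz : x = h z by rewrite homeo_lineVK.
have x_le : x <= h (t z) by rewrite xz homeo_line_le on_cells_doubling_ge.
suff [xt|zt] : x < t x \/ z < t z.
- by apply: (lt_le_trans xt); rewrite homeo_line_le.
- apply: lt_le_trans (on_cells_doubling_ge _ _).
  by rewrite [ltLHS]xz homeo_line_lt.
have x_ge0 : 0 <= x by apply: le_trans x0x.
have := truncn_itv x_ge0; set n := Num.truncn x => /andP[nx xn].
have n0 : (next 0%N < n)%N by rewrite truncn_ge_nat.
have [|noDn] := boolP (D n && (n%:R < x)).
  by move=> /andP[Dn nx']; left; apply: (on_cells_doubling_gt Dn); rewrite nx'.
right.
(* x is fixed by t, and k is the last cell of [D] before x; its image under h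
   contains x. *)
pose Q k := (k < n)%N && D k.
have exQ : exists k, Q k by exists (next 0%N); rewrite /Q n0 next_D.
have Qn k : Q k -> (k <= n)%N by move=> /andP[/ltnW].
case: (ex_maxnP exQ Qn) => k /andP[kn Dk] kmax.
have nk : next k = k by apply/eqP; rewrite eqn_leq next_ge next_min.
have nn : (n <= next k.+1)%N.
  rewrite leqNgt; apply/negP => lt.
  by have := kmax (next k.+1); rewrite /Q lt next_D leqNgt next_ge => /(_ isT).
apply: (on_cells_doubling_gt Dk).
rewrite -[_ < z](homeo_line_lt h) -[z < _](homeo_line_lt h) -xz !hE.
apply/andP; split.
  apply: (lt_le_trans (p_lt1 k)); rewrite nk; apply: le_trans nx.
  by rewrite ler_nat.
move: noDn; rewrite negb_and -leNgt => /orP[nDn|xn']; last first.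
  by apply: (le_lt_trans xn'); apply: le_lt_trans (p_gt _); rewrite ler_nat.
apply: (lt_trans xn); apply: le_lt_trans (p_gt _).
rewrite ler_nat ltn_neqAle nn andbT.
by apply: contraNneq nDn => ->; rewrite next_D.
Qed.

(** As both f and g^-1 f move all points up, and g = f (g^-1 f)^-1, such
    elements generate the group. *)
Lemma dominating g : exists f, forall x, x < f x /\ g x < f x.
Proof.
have E : homeo_line_of (fun x => Num.max (g x) x + 1) =1
    fun x => Num.max (g x) x + 1.
  apply: (@homeo_line_ofE _ _ (fun y => Num.min (g^-1%g (y - 1)) (y - 1))).
    move=> x y xy; rewrite ltrD2r gt_max !lt_max homeo_line_lt xy /=.
    by rewrite orbT.
  move=> y /=; set z := y - 1.
  case: (leP (g^-1%g z) z) => [zg|zg].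
    by rewrite homeo_lineVK max_l ?subrK.
  rewrite max_r ?subrK// -[leRHS](homeo_lineVK g) homeo_line_le.
  exact: ltW.
exists (homeo_line_of (fun x => Num.max (g x) x + 1)) => x; rewrite E.
by split; rewrite ltr_pwDr// le_max lexx ?orbT.
Qed.

(** Everything reduces to the unit translation, to which all elements moving
    points up are conjugate, and to one such element in the kernel. *)
Theorem germ_morphism_trivial (H : groupType)
    (phi : {multiplicative germ_infty R -> H}) :
  separable_group H -> forall a, phi a = 1%g.
Proof.
move=> sepH.
pose gi := germ_image phi.
have trans f x0 : (forall x, x0 <= x -> x < f x) ->
    exists u, gi f = (u * gi (affine 1 1) * u^-1)%g.
  move=> /conj_translation[h hf]; exists (gi h).
  apply: (@mulIg _ (gi h)); rewrite mulgVK /gi -!germ_imageM.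
  apply: (@germ_image_eq _ _ _ _ _ 0) => x x0_le.
  by rewrite !homeo_lineME affineE// mul1r hf.
have [D [Doo D1]] := trivial_on_infinitely_many_cells phi sepH.
have [h [x0 hx0]] := moves_up_by_two_conjugates Doo.
have shift1 : gi (affine 1 1) = 1%g.
  have [u uE] := trans _ _ hx0.
  move: uE; rewrite /gi !germ_imageM D1 mul1g mulg1 germ_imageV mulgV => /esym.
  move=> /(congr1 (fun v => u^-1 * v * u)%g).
  by rewrite mulg1 mulVg !mulgA mulVg mul1g mulgVK.
have up1 f : (forall x, x < f x) -> gi f = 1%g.
  move=> fx; have [u ->] := trans f 0 (fun x _ => fx x).
  by rewrite shift1 mulg1 mulgV.
elim/quotW => g; rewrite -[LHS]/(gi g).
have [f fg] := dominating g.
have f1 : gi f = 1%g by apply: up1 => x; case: (fg x).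
have : gi (g^-1 * f)%g = 1%g.
  apply: up1 => x; rewrite homeo_lineME -(homeo_line_lt g) homeo_lineVK.
  by case: (fg x).
rewrite /gi germ_imageM germ_imageV [X in (_ * X)%g]f1 mulg1 => g1.
by rewrite -[LHS]invgK g1 invg1.
Qed.

End Conjugation.

(** * Separability of the homeomorphism group of the circle *)

Section Circle.
Variable R : realType.

Lemma continuous_unif_bound (u : R -> R * R) (d : R) : continuous u -> 0 < d ->
  exists N : nat, forall t, -1 <= t <= 1 ->
    forall s, `|s - t| <= N.+1%:R^-1 -> `|u s - u t| <= d.
Proof.
move=> uc d0.
have K : compact `[(-1 : R), 1] := @segment_compact _ _ _.
have /compact_near_coveringP/(_ nat \oo (fun N t =>
  forall s, `|s - t| <= N.+1%:R^-1 -> `|u s - u t| <= d)) := K.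
case=> [t _|N _ hN].
  have d20 : 0 < d / 2 by lra.
  have /cvgrPdist_lt/(_ _ d20)/nbhs_ballP[r /= r0 hr] := uc t.
  have r20 : 0 < r / 2 by lra.
  exists (ball t (r / 2), [set N | N.+1%:R^-1 < r / 2]).
    split; first exact: nbhsx_ballx.
    exact: near_infty_natSinv_lt (PosNum r20).
  move=> [t' N] /= [tt' Nr] s st'.
  rewrite /ball/= in tt'.
  have {Nr}st' : `|s - t'| < r / 2 := le_lt_trans st' Nr.
  have h1 : `|u t - u s| < d / 2.
    apply: hr; rewrite /ball/=; have := ler_distD t' t s.
    by rewrite (distrC t' s); lra.
  have h2 : `|u t - u t'| < d / 2 by apply: hr; rewrite /ball/=; lra.
  have := ler_distD (u t) (u s) (u t').
  by rewrite distrC in h1; lra.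
by exists N => t t1; apply: (hN N) => //=.
Qed.

Lemma floor_eq_dist (a b d : R) : 0 < d ->
  Num.floor (a / d) = Num.floor (b / d) -> `|a - b| <= d.
Proof.
move=> d0 ab.
have /andP[a1 a2] := floor_itv (a / d); have /andP[b1 b2] := floor_itv (b / d).
rewrite ab in a1 a2; rewrite intrD in a2 b2.
have : `|a / d - b / d| <= 1 by rewrite ler_norml; lra.
rewrite -mulrBl normrM (gtr0_norm (_ : 0 < d^-1)) ?invr_gt0//.
by rewrite ler_pdivrMr// mul1r.
Qed.

(** A curve is coded by a modulus of uniform continuity at scale e, together
    with the e-approximate values on a grid as fine as this modulus. *)
Lemma continuous_curves_separable (d : R) : 0 < d ->
  exists c : (R -> R * R) -> nat, forall u v, continuous u -> continuous v ->
    c u = c v -> forall t, -1 <= t <= 1 -> `|u t - v t| <= d.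
Proof.
move=> d0; pose e := d / 3; have e0 : 0 < e by rewrite /e; lra.
have /choice[N hN] (u : R -> R * R) : exists N : nat, continuous u ->
    forall t, -1 <= t <= 1 ->
    forall s, `|s - t| <= N.+1%:R^-1 -> `|u s - u t| <= e.
  have [uc|nuc] := pselect (continuous u); last by exists 0%N.
  by have [N hN] := continuous_unif_bound uc e0; exists N.
pose node n k : R := k%:R / n.+1%:R - 1.
pose samples n u := [seq (Num.floor ((u (node n k)).1 / e),
  Num.floor ((u (node n k)).2 / e)) | k <- iota 0 (2 * n.+1).+1].
exists (fun u => pickle (N u, samples (N u) u)) => u v uc vc.
move=> /(pcan_inj pickleK) E; have Nuv : N u = N v := congr1 fst E.
have : samples (N u) u = samples (N v) v := congr1 snd E.
rewrite -Nuv => /eq_in_map uv t t1.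
set n := N u in Nuv uv.
have n0 : 0 < n.+1%:R :> R by rewrite ltr0n.
pose x := (t + 1) * n.+1%:R; pose k := Num.truncn x.
have x0 : 0 <= x by rewrite mulr_ge0//; lra.
have /andP[kx xk] := truncn_itv x0.
have kn : (k < (2 * n.+1).+1)%N.
  rewrite ltnS -(ler_nat R) (le_trans kx)// natrM /x ler_pM2r//; lra.
have nodet : `|node n k - t| <= n.+1%:R^-1.
  have -> : node n k - t = (k%:R - x) / n.+1%:R.
    by rewrite /node /x; field; rewrite lt0r_neq0.
  rewrite normrM (gtr0_norm (_ : 0 < n.+1%:R^-1)) ?invr_gt0// ler_pdivrMr//.
  rewrite mulVf ?lt0r_neq0// ler_norml.
  by move: xk; rewrite -natr1 -/k => xk; lra.
have h1 := hN u uc t t1 _ nodet.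
have h2 : `|v (node n k) - v t| <= e by apply: hN => //; rewrite -Nuv.
have kI : k \in iota 0 (2 * n.+1).+1 by rewrite mem_iota add0n kn.
case: (uv k kI) => /(floor_eq_dist e0) f1 /(floor_eq_dist e0) f2.
have h3 : `|u (node n k) - v (node n k)| <= e.
  by rewrite prod_normE ge_max f1 f2.
have := ler_distD (u (node n k)) (u t) (v t).
have := ler_distD (v (node n k)) (u (node n k)) (v t).
by rewrite [in `|u t - u _|]distrC; move: h1 h2 h3; rewrite /e; lra.
Qed.

Lemma circle_param_surj (z : circle R) :
  exists2 t, -1 <= t <= 1 & circle_param t = z.
Proof.
have : (val z).1 ^+ 2 + (val z).2 ^+ 2 = 1 by have := valP z; rewrite inE.
case E : (val z) => [a b] /= ab.
have a1 : -1 <= a <= 1.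
  rewrite -ler_norml -(@ler_pXn2r _ 2)// ?nnegrE// expr1n.
  by rewrite real_normK ?num_real//; nra.
have p0 := pi_gt0 R.
pose t := acos a / (2 * pi).
have t2 : 2 * pi * t = acos a.
  by rewrite /t mulrC divfK ?lt0r_neq0 ?mulr_gt0.
have t01 : 0 <= t <= 1.
  have tp0 : 0 < 2 * pi :> R by rewrite mulr_gt0.
  have := acos_ge0 a1; have := acos_lepi a1; rewrite -t2 => tp t0.
  by rewrite -(ler_pM2l tp0 0) -(ler_pM2l tp0 _ 1) mulr0 mulr1 t0/=; lra.
have sb : sin (acos a) = `|b|.
  rewrite sin_acos// -sqrtr_sqr; congr Num.sqrt; lra.
have ca : cos (acos a) = a by apply: acosK; rewrite in_itv.
have [b0|b0] := leP 0 b.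
  exists t; first by lra.
  by apply: val_inj; rewrite /= t2 ca sb ger0_norm.
exists (- t); first by lra.
by apply: val_inj; rewrite /= mulrN t2 cosN sinN ca sb ltr0_norm// opprK.
Qed.

(** The ball of radius e about 1 for the uniform distance, which is invariant
    under right translations. *)
Definition displacement_le (e : R) (h : homeo_circle R) : Prop :=
  forall z : circle R, `|val (h z) - val z| <= e.

Lemma displacement_leM e e' h h' :
  displacement_le e h -> displacement_le e' h' ->
  displacement_le (e + e') (h * h')%g.
Proof.
move=> he he' z; apply: (le_trans (ler_distD (val (h' z)) _ _)).
by rewrite lerD// he.
Qed.

Lemma displacement_leV e h : displacement_le e h -> displacement_le e h^-1%g.
Proof. by move=> he z; have := he (h^-1%g z); rewrite homeoVK distrC. Qed.

(** A homeomorphism is seen as the curve t |-> f (circle_param t), whose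
    continuity follows from that of a lift. The quotient of two elements that
    are uniformly close has small displacement, and displacements add up in a
    commutator. *)
Lemma homeo_circle_separable :
  separable_group (homeo_circle R).
Proof.
exists (fun m => displacement_le (m.+1%:R^-1)); split => [m|h hm]; last first.
  do 2! apply: val_inj; apply/funext => z; apply: val_inj.
  apply/eqP; rewrite -subr_eq0 -normr_le0; apply/ler_addgt0Pr => e e0.
  rewrite add0r.
  near \oo => m.
  apply: (le_trans (hm m z)); apply/ltW; near: m.
  exact: near_infty_natSinv_lt (PosNum e0).
(* A commutator is a product of four factors. *)
pose d : R := m.+1%:R^-1 / 4.
have d0 : 0 < d by rewrite divr_gt0// invr_gt0 ltr0n.
have [c hc] := continuous_curves_separable d0.
pose curve (f : homeo_circle R) t := val (f (circle_param t)).
have curve_cont f : continuous (curve f).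
  have [F fF] := homeo_circle_lift f.
  have -> : curve f = (fun t => (cos (2 * pi * F t), sin (2 * pi * F t))).
    by apply/funext => t; rewrite /curve fF.
  have [Fc _] := homeoP F.
  have cF : continuous (fun t => 2 * pi * F t).
    by move=> t; apply: cvgM; [exact: cvg_cst|exact: Fc].
  move=> t; apply: (@cvg_pair _ _ _ (nbhs t) (nbhs (cos (2 * pi * F t)))
    (nbhs (sin (2 * pi * F t)))); apply: continuous_cvg (cF t).
    exact: continuous_cos.
  exact: continuous_sin.
have close f g : c (curve f) = c (curve g) -> displacement_le d (f / g)%g.
  move=> /hc fg z; have [t t1 tz] := circle_param_surj (g^-1%g z).
  have := fg (@curve_cont f) (@curve_cont g) t t1.
  by rewrite /curve tz homeoVK.
exists (fun f => c (curve f)) => a a' b b' /close aa /close bb.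
have := displacement_leM (displacement_leM (displacement_leM aa bb)
  (displacement_leV aa)) (displacement_leV bb).
suff -> : d + d + d + d = m.+1%:R^-1 by [].
by rewrite /d; move: (m.+1%:R^-1) => x; field.
Unshelve. all: by end_near. Qed.

End Circle.

Theorem proposition4p3 (R : realType) :
  ~ exists phi : {multiplicative germ_infty R -> homeo_circle R},
      exists g : germ_infty R, phi g <> 1%g.
Proof.
move=> [phi [g]]; apply.
exact: germ_morphism_trivial (homeo_circle_separable R) g.
Qed.
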